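(* For all integers $n,k$ with $2\le k\le n/2$ there exists a cyclic descent map for the shape $(n-k,k)$. Such a map $\mathrm{cDes}:\mathrm{SYT}(n-k,k)\to 2^{[n]}$ is specified by letting, for $T\in\mathrm{SYT}(n-k,k)$, $n\in\mathrm{cDes}(T)$ if and only if both of the following conditions hold: 1. the last two entries in the second row of $T$ are consecutive, that is, $T_{2,k}=T_{2,k-1}+1$; 2. for every $1<i<k$, $T_{2,i-1}>T_{1,i}$.
   Context: Let $[n]=\{1,\dots,n\}$ and let $2^{[n]}$ be the set of subsets of $[n]$. Tableaux are drawn in English notation (row 1 on top), and $T_{i,j}$ is the entry of $T$ in row $i$ (from the top) and column $j$ (from the left). For a (possibly skew) shape $\lambda/\mu$ with $n$ cells, $\mathrm{SYT}(\lambda/\mu)$ is the set of standard Young tableaux of that shape. The descent set of $T\in\mathrm{SYT}(\lambda/\mu)$ is $\mathrm{Des}(T)=\{i\in[n-1] : i+1 \text{ is in a lower row than } i \text{ in } T\}$. A cyclic descent map for $\lambda/\mu$ is a map $\mathrm{cDes}:\mathrm{SYT}(\lambda/\mu)\to 2^{[n]}$ such that (i) $\mathrm{cDes}(T)\cap[n-1]=\mathrm{Des}(T)$ for every $T$; and (ii) the multiset $\{\!\{\mathrm{cDes}(T): T\in\mathrm{SYT}(\lambda/\mu)\}\!\}$ is closed under cyclic rotation modulo $n$, i.e. it is invariant under replacing each set $D$ by $1+D$, obtained by adding $1$ modulo $n$ to every element of $D$. By (i), such a map is determined by specifying for which $T$ one has $n\in\mathrm{cDes}(T)$. *)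

(* Defs.v *)
From HB Require Import structures.
From mathcomp Require Import all_boot.

Set Implicit Arguments.
Unset Strict Implicit.
Unset Printing Implicit Defensive.

(* The cells of the skew shape lam/mu, where lam and mu are partitions given   *)
(* as non-increasing lists of row lengths.  Positions are 0-based internally;  *)
(* row and col below are 1-based, counted from the top and from the left.      *)
Definition in_skew (lam mu : seq nat)
    (c : 'I_(size lam) * 'I_(head 0 lam)) : bool :=
  nth 0 mu c.1 <= c.2 < nth 0 lam c.1.

Record cell (lam mu : seq nat) : Type := Cell {
  cell_pos : 'I_(size lam) * 'I_(head 0 lam);
  cell_posP : in_skew mu cell_pos
}.

HB.instance Definition _ lam mu := [isSub for @cell_pos lam mu].
HB.instance Definition _ lam mu := [Finite of cell lam mu by <:].

Definition row lam mu (c : cell lam mu) : nat := (cell_pos c).1.+1.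
Definition col lam mu (c : cell lam mu) : nat := (cell_pos c).2.+1.

(* Throughout, the ordinal m : 'I_n stands for the element m.+1 of [n], so     *)
(* that subsets of [n] are elements of {set 'I_n}.                             *)
Definition is_SYT n lam mu (T : {ffun cell lam mu -> 'I_n}) : bool :=
  [&& [forall v, #|[set c | T c == v]| == 1],
      [forall c, forall d, (row c == row d) && (col c < col d) ==> (T c < T d)]
    & [forall c, forall d, (col c == col d) && (row c < row d) ==> (T c < T d)]].

(* Empty unless lam/mu has exactly n cells. *)
Record SYT (n : nat) (lam mu : seq nat) : Type := MkSYT {
  syt_val :> {ffun cell lam mu -> 'I_n};
  syt_valP : is_SYT syt_val
}.

HB.instance Definition _ n lam mu := [isSub for @syt_val n lam mu].
HB.instance Definition _ n lam mu := [Finite of SYT n lam mu by <:].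

(* T_{i,j}, a number in {1, ..., n}; the junk value is 0 when (i, j) is not a  *)
(* cell of the shape.                                                          *)
Definition entry n lam mu (T : SYT n lam mu) (i j : nat) : nat :=
  if [pick c | (row c == i) && (col c == j)] is Some c then (T c).+1 else 0.

(* The condition T d = (T c).+1 forces the descent m.+1 to lie in [n-1]. *)
Definition Des n lam mu (T : SYT n lam mu) : {set 'I_n} :=
  [set m : 'I_n | [exists c, exists d,
     [&& T c == m, T d == m.+1 :> nat & row c < row d]]].

(* 1 + D, with addition modulo n: ordS is the cyclic successor on 'I_n. *)
Definition rotate n (D : {set 'I_n}) : {set 'I_n} := [set ordS m | m in D].

(* Multisets of subsets of [n] are sequences up to perm_eq. *)
Definition cyclic_descent_map n lam mu
    (cDes : SYT n lam mu -> {set 'I_n}) : Prop :=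
  (forall T, cDes T :&: [set m : 'I_n | m.+1 < n] = Des T) /\
  perm_eq [seq rotate (cDes T) | T : SYT n lam mu]
          [seq cDes T | T : SYT n lam mu].

(* Main.v *)
Require Import Defs.
From mathcomp Require Import all_boot zify.

(** A two-row standard tableau is read as a word: its i-th letter is an up step
    ([false]) or a down step ([true]) according to whether the entry i lies in
    the upper or the lower row.  Columns increase exactly when the word is a
    ballot word (no prefix has more downs than ups), and the descents are the
    peaks, that is, the up steps immediately followed by a down step.

    For a subset S of [n], let N_j(S) be the number of words of length n with
    j downs whose cyclic peak set (the first letter being the successor of the
    last) is S.  Rotating a word rotates its cyclic peak set, so N_j is
    invariant under rotation of S ([count_cpeaks_rotate]).  The theorem
    therefore follows from the formula ([count_cdes])

      #{T : cDes T = S} = N_k(S) - N_(k-1)(S).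

    Its source is a reflection principle that respects linear peaks
    ([count_ballot]): a word with j+1 downs that is not ballot is turned into a
    word with j downs by flipping the down step at which its path first reaches
    its minimum.  That step is neither preceded by an up step nor followed by a
    down step, so no peak is created or destroyed.  Hence the ballot words with
    k downs and a given peak set are counted by a difference of two counts of
    unrestricted words.

    - If n belongs to S, the words counted by N_j(S) are those of the form
      (down) x (up), so by reflection N_k(S) - N_(k-1)(S) counts ballot words x
      of length n-2 with k-1 downs.  On the other side, the two conditions that
      put n in cDes T say that the path of T stays strictly positive up to its
      last two down steps, which are adjacent ([framedP]).  Deleting the first
      up step and one of these two down steps gives a ballot word x as above,
      and this is reversible with the same peaks on both sides
      ([count_cdes_max], [count_cpeaks_max]).
    - If n does not belong to S, the words with linear peak set S have cyclic
      peak set S or S together with n, and likewise the tableaux with descent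
      set S have cyclic descent set S or S together with n
      ([count_split_max]).  Reflection in length n gives the formula for the
      sum of the two cases, and the previous point is subtracted. *)

Set Implicit Arguments.
Unset Strict Implicit.
Unset Printing Implicit Defensive.

(** * Ballot words *)

(** The path that starts at height [h] never goes below height 0; a general
    [h] is what makes recursion on the word possible. *)
Fixpoint ballot (h : nat) (w : seq bool) : bool :=
  if w is a :: w' then
    if a then (0 < h) && ballot h.-1 w' else ballot h.+1 w'
  else true.

Notation letters b w := (@count bool (eqb b) w).
Notation downs w := (letters true w).
Notation ups w := (letters false w).

Lemma ballotW h w : ballot h w -> ballot h.+1 w.
Proof.
elim: w h => //= -[] w IHw [|h] //=; try exact: IHw.
Qed.

Lemma ballot0W h w : ballot 0 w -> ballot h w.
Proof. by move=> w0; elim: h => // h; apply: ballotW. Qed.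

Lemma ups_downs w : ups w + downs w = size w.
Proof. by elim: w => //= -[] w /=; lia. Qed.

Lemma ballotP h w :
  reflect (forall t, downs (take t w) <= h + ups (take t w)) (ballot h w).
Proof.
elim: w h => [|[] w IHw] h /=; first by constructor.
- case: h => [|h] /=; first by constructor=> /(_ 1); rewrite /= take0.
  apply: (iffP (IHw h)) => Hw t; last by have := Hw t.+1; rewrite /=; lia.
  by case: t => [|t] //=; have := Hw t; rewrite /=; lia.
- apply: (iffP (IHw h.+1)) => Hw t; last by have := Hw t.+1; rewrite /=; lia.
  by case: t => [|t] //=; have := Hw t; rewrite /=; lia.
Qed.

Lemma ballot_no_down h w : downs w = 0 -> ballot h w.
Proof. by elim: w h => [|[] w IHw] h //= w0; apply: IHw. Qed.

Lemma ballot_cat h u v : 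
  ballot h (u ++ v) = ballot h u && ballot (h + ups u - downs u) v.
Proof.
elim: u h => [|[] u IHu] h /=; first by rewrite addn0 subn0.
- by case: h => [|h] //=; rewrite IHu; congr (_ && ballot _ _).
- rewrite IHu; congr (_ && ballot _ _); lia.
Qed.

(** * The reflection principle, with peaks *)

(** The default values make both conditions fail beyond the end of the word, so
    that the last letter is never a peak. *)
Definition peak (w : seq bool) (i : nat) : bool :=
  ~~ nth true w i && nth false w i.+1.

(** On a word that is not ballot, this flips the down step at which the path
    first reaches its minimum: the suffix that starts at position t is ballot
    exactly when the path never goes below its height at t, so the first
    minimum is where the first ballot suffix starts. *)
Fixpoint raise (w : seq bool) : seq bool :=
  if w is a :: w' then
    if ballot 0 w' then ~~ a :: w' else a :: raise w'
  else [::].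

(** The inverse of [raise]: flips the up step by which the path leaves its
    minimum for the last time, provided there is one ([sinkable]). *)
Fixpoint sink (w : seq bool) : seq bool :=
  if w is a :: w' then
    if ~~ a && ballot 0 w' then true :: w' else a :: sink w'
  else [::].

Fixpoint sinkable (w : seq bool) : bool :=
  if w is a :: w' then ~~ a && ballot 0 w' || sinkable w' else false.

Lemma size_raise w : size (raise w) = size w.
Proof. by elim: w => //= a w IHw; case: ifP => //= _; rewrite IHw. Qed.

Lemma size_sink w : size (sink w) = size w.
Proof. by elim: w => //= a w IHw; case: ifP => //= _; rewrite IHw. Qed.

(** Raising lifts the minimum of the path by exactly one. *)
Lemma ballot_raise h w : ~~ ballot 0 w -> ballot h (raise w) = ballot h.+1 w.
Proof.
elim: w h => //= a w IHw h; case: (boolP (ballot 0 w)) => w0 /=.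
  by case: a => //=; rewrite ?ballotW ?(ballot0W _ w0).
case: a => /=; last by rewrite IHw.
by case: h => [|h] _ /=; [rewrite (negbTE w0) | rewrite IHw].
Qed.

(** Sinking lowers the minimum of the path by exactly one; the two claims need
    each other in the induction. *)
Lemma ballot_sink h w :
  sinkable w -> ballot h.+1 (sink w) = ballot h w /\ ballot 0 (sink w) = false.
Proof.
elim: w h => //= a w IHw h; case: ifP => [/andP[a0 w0] _|aw] /=.
  by rewrite (negbTE a0) !(ballot0W _ w0).
move=> sw; case: a aw => /= [_|w0]; last first.
  by have [-> _] := IHw h.+1 sw; have [-> _] := IHw 0 sw.
split=> //; case: h => [|h] /=; first by have [] := IHw 0 sw.
by have [] := IHw h sw.
Qed.

Lemma raiseK w : ~~ ballot 0 w -> sinkable (raise w) /\ sink (raise w) = w.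
Proof.
elim: w => //= a w IHw; case: (boolP (ballot 0 w)) => w0 /=.
  by case: a => //=; rewrite ?ballotW // w0.
move=> aw; have [-> ->] := IHw w0; rewrite orbT; split=> //.
by case: a aw => //=; rewrite ballot_raise // => /negbTE->.
Qed.

Lemma sinkK w : sinkable w -> raise (sink w) = w.
Proof.
elim: w => //= a w IHw; case: ifP => [/andP[a0 w0] _|aw] /=.
  by rewrite w0; case: a a0.
by move=> sw; have [_ ->] := ballot_sink 0 sw; rewrite IHw.
Qed.

Lemma downs_raise w : ~~ ballot 0 w -> downs w = (downs (raise w)).+1.
Proof.
elim: w => //= a w IHw; case: (boolP (ballot 0 w)) => w0 /=.
  by case: a => //=; rewrite ballotW.
by move=> _; rewrite IHw //; lia.
Qed.

(** Before the flipped step there cannot be an up step, as the minimum would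
    have been reached earlier, and after it there cannot be a down step, as the
    path would go lower. *)
Lemma peak_raise w i : ~~ ballot 0 w -> peak (raise w) i = peak w i.
Proof.
elim: w i => //= a w IHw i; case: (boolP (ballot 0 w)) => w0 /=.
  case: a => /= [_|]; last by rewrite ballotW.
  case: i => [|i] //; rewrite /peak /=.
  by case: w w0 {IHw} => // -[].
move=> aw; case: i => [|i]; last exact: IHw.
rewrite /peak /=; case: a aw => //=.
case: w w0 {IHw} => //= b w; case: (boolP (ballot 0 w)) => // ww.
by case: b; rewrite // ballotW.
Qed.

(** Without an up step that leaves the minimum for good, the path ends at its
    minimum, so that being ballot is a condition on the end point alone. *)
Lemma unsinkable_ballot h w :
  ~~ sinkable w -> ballot h w = (downs w <= h + ups w) /\ ups w <= downs w.
Proof.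
elim: w h => [|a w IHw] h /=; first by [].
rewrite negb_or => /andP[aw sw]; have [E1 E2] := IHw h.+1 sw.
case: a aw => /= [_|w0].
  case: h E1 => [|h] _ /=; first by split; lia.
  by have [-> _] := IHw h sw; split; lia.
have [E3 _] := IHw 0 sw; rewrite E1; split; first lia.
move: w0; rewrite E3; lia.
Qed.

Lemma sinkable_ups w : downs w < ups w -> sinkable w.
Proof.
by move=> lt_w; apply/negPn/negP => /(unsinkable_ballot 0)[_]; lia.
Qed.

(** * Counting words *)

(** A sequence rather than a finite type, so that words of different lengths
    are compared without casts. *)
Definition words (n : nat) : seq (seq bool) :=
  [seq val t | t <- enum {: n.-tuple bool}].

Lemma mem_words n w : (w \in words n) = (size w == n).
Proof.
apply/mapP/eqP => [[t _ ->]|szw]; first exact: size_tuple.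
by exists (tcast szw (in_tuple w)); rewrite ?mem_enum //= val_tcast.
Qed.

Lemma uniq_words n : uniq (words n).
Proof. by rewrite map_inj_uniq ?enum_uniq //; apply: val_inj. Qed.

Lemma count_words_bij m n (P Q : pred (seq bool)) (f g : seq bool -> seq bool) :
  (forall w, size w = m -> P w -> [/\ size (f w) = n, Q (f w) & g (f w) = w]) ->
  (forall w, size w = n -> Q w -> [/\ size (g w) = m, P (g w) & f (g w) = w]) ->
  count P (words m) = count Q (words n).
Proof.
move=> fP gQ; rewrite -!size_filter -(size_map f); apply/perm_size/uniq_perm.
- rewrite map_inj_in_uniq ?filter_uniq ?uniq_words // => u v.
  rewrite !mem_filter !mem_words => /andP[Pu /eqP su] /andP[Pv /eqP sv] Euv.
  by have [_ _ <-] := fP u su Pu; have [_ _ <-] := fP v sv Pv; rewrite Euv.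
- by rewrite filter_uniq ?uniq_words.
move=> w; rewrite mem_filter mem_words; apply/mapP/andP => [[u]|[Qw /eqP sw]].
  rewrite mem_filter mem_words => /andP[Pu /eqP su] ->.
  by have [-> -> _] := fP u su Pu.
have [s1 p1 e1] := gQ w sw Qw.
by exists (g w); rewrite // mem_filter mem_words s1 p1 eqxx.
Qed.

Lemma count_split T (a b : pred T) s :
  count a s = count (fun x => a x && b x) s + count (fun x => a x && ~~ b x) s.
Proof. by elim: s => //= x s ->; case: (a x); case: (b x) => /=; lia. Qed.

Lemma eq_count_words n (P Q : pred (seq bool)) :
  (forall w, size w = n -> P w = Q w) -> count P (words n) = count Q (words n).
Proof. by move=> PQ; apply: eq_in_count => w; rewrite mem_words => /eqP/PQ. Qed.

(** The non-ballot words on the left are matched with the words having one down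
    less by [raise] and [sink].  The bound on [j] ensures that the latter have
    more ups than downs, hence are sinkable. *)
Lemma count_ballot n j (P : pred (seq bool)) : 2 * j < n ->
  (forall u v, peak u =1 peak v -> P u = P v) ->
  count (fun w => P w && (downs w == j.+1)) (words n) =
  count (fun w => [&& P w, downs w == j.+1 & ballot 0 w]) (words n)
  + count (fun w => P w && (downs w == j)) (words n).
Proof.
move=> lt_jn Pext; rewrite (count_split _ (ballot 0)); congr (_ + _).
  by apply: eq_count => w; rewrite andbA.
apply: (count_words_bij (f := raise) (g := sink)) => w sw.
  case/andP=> /andP[Pw dw] w0; rewrite size_raise; have [_ ->] := raiseK w0.
  split=> //; have := downs_raise w0; rewrite (eqP dw) => -[<-].
  by rewrite eqxx andbT -(Pext w) // => i; rewrite peak_raise.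
case/andP=> Pw /eqP dw.
have sk : sinkable w by apply: sinkable_ups; have := ups_downs w; lia.
have [_ /negbT w0] := ballot_sink 0 sk.
rewrite size_sink sinkK // w0 andbT; split=> //.
have := downs_raise w0; rewrite sinkK // dw => ->; rewrite eqxx andbT.
by rewrite -(Pext w) // => i; rewrite -(peak_raise _ w0) sinkK.
Qed.

(** * Doubling the last down step *)
Fixpoint dup_last (w : seq bool) : seq bool :=
  if w is a :: w' then
    if a && (true \notin w') then [:: true, true & w'] else a :: dup_last w'
  else [::].

Fixpoint del_last (w : seq bool) : seq bool :=
  if w is a :: w' then
    if a && (true \notin w') then w' else a :: del_last w'
  else [::].

Lemma last_down w : true \in w ->
  exists u v, w = u ++ true :: v /\ true \notin v.
Proof.
elim: w => //= a w IHw; case: (boolP (true \in w)) => [/IHw[u [v [-> ?]]] _|wN].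
  by exists (a :: u), v.
by rewrite inE (negbTE wN) orbF => /eqP <-; exists [::], w.
Qed.

Lemma dup_lastE u v : true \notin v -> 
  dup_last (u ++ true :: v) = u ++ [:: true, true & v].
Proof.
move=> vN; elim: u => [|a u IHu] /=; first by rewrite vN.
by rewrite mem_cat inE eqxx orbT andbF IHu.
Qed.

Lemma del_lastE u v : true \notin v -> del_last (u ++ true :: v) = u ++ v.
Proof.
move=> vN; elim: u => [|a u IHu] /=; first by rewrite vN.
by rewrite mem_cat inE eqxx orbT andbF IHu.
Qed.

Lemma dup_lastK w : true \in w -> del_last (dup_last w) = w.
Proof.
case/last_down => u [v [-> vN]]; rewrite dup_lastE //.
by rewrite -cat1s catA del_lastE // -catA.
Qed.

Lemma downs_mem w : (0 < downs w) = (true \in w).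
Proof. by elim: w => //= -[] w IHw; rewrite inE. Qed.

Lemma size_dup_last w : true \in w -> size (dup_last w) = (size w).+1.
Proof.
by case/last_down => u [v [-> vN]]; rewrite dup_lastE // !size_cat /=; lia.
Qed.

Lemma downs_dup_last w : true \in w -> downs (dup_last w) = (downs w).+1.
Proof.
by case/last_down => u [v [-> vN]]; rewrite dup_lastE // !count_cat /=; lia.
Qed.

Lemma ballot_dup_last h w : ballot h w -> ballot h.+1 (dup_last w).
Proof.
elim: w h => //= -[] w IHw h /=; last exact: IHw.
by case: h => //= h wh; case: (true \in w) => /=; [apply: IHw | rewrite wh].
Qed.

(** There is no peak from the last down step on, so shifting the final run of
    up steps by one place does not move any peak. *)
Lemma peak_dup_last w i : peak (dup_last w) i = peak w i.
Proof.
elim: w i => //= a w IHw i.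
case: ifP => [/andP[aT wN]|aw].
  rewrite aT; have peakN j b : peak (b :: w) j = false.
    rewrite /peak /=.
    have /negbTE-> : ~~ nth false w j; last by rewrite andbF.
    case: (ltnP j (size w)) => [ltj|?]; last by rewrite nth_default.
    by apply: contra wN => nT; rewrite -[true]nT mem_nth.
  by case: i => [|i] //; rewrite -[LHS]/(peak (true :: w) i) !peakN.
case: i => [|i]; last exact: IHw.
rewrite /peak /=; congr (_ && _).
by case: w aw {IHw} => //= b w; case: a; case: b => //=; case: ifP.
Qed.

Lemma peakF w i : size w <= i.+1 -> peak w i = false.
Proof. by move=> le_wi; rewrite /peak (nth_default false) // andbF. Qed.

(** * Peak sets of words *)

(** The words of the tableaux that have [n] as a cyclic descent: an up step
    followed by a ballot word, with at least one down step, whose last down step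
    has been doubled.  The meaning in terms of entries is given by [framedP]. *)
Definition framed (w : seq bool) : bool :=
  if w is a :: y then
    [&& ~~ a, true \in del_last y, dup_last (del_last y) == y
      & ballot 0 (del_last y)]
  else false.

Definition cpeaks n (w : seq bool) : {set 'I_n} :=
  [set i : 'I_n | ~~ nth true w i && nth false w (ordS i)].

Definition peaks n (w : seq bool) : {set 'I_n} := [set i : 'I_n | peak w i].

Definition cdes n (w : seq bool) : {set 'I_n} :=
  [set i : 'I_n | peak w i || (i.+1 == n) && framed w].

(** The peaks of [x], shifted by one, together with the last position: the
    cyclic peak set of the word obtained from [x] by putting a down step in
    front and an up step at the end. *)
Definition inner n (x : seq bool) : {set 'I_n} :=
  [set i : 'I_n | (i.+1 == n) || (0 < i) && peak x i.-1].

Lemma framed_dup_last x : true \in x -> ballot 0 x ->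
  framed (false :: dup_last x).
Proof. by move=> xT x0; rewrite /= dup_lastK // xT eqxx. Qed.

Lemma ordS_val n (i : 'I_n) : ordS i = (if i.+1 == n then 0 else i.+1) :> nat.
Proof.
rewrite /=; have := ltn_ord i; rewrite -ltnS ltnS leq_eqVlt.
by case: eqP => [->|_ /= lt_in]; rewrite ?modnn ?modn_small.
Qed.

Lemma cpeaksE n w : size w = n ->
  cpeaks n w =
  [set i : 'I_n | peak w i || [&& i.+1 == n, ~~ last true w & head false w]].
Proof.
move=> sw; apply/setP=> i; rewrite !inE ordS_val.
case: eqP => [Ein|ne]; last by rewrite orbF.
rewrite peakF /=; last by rewrite sw Ein.
by rewrite nth0 -nth_last sw -[X in X.-1]Ein.
Qed.

Lemma cpeaks_bracket m x : size x = m ->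
  cpeaks m.+2 (true :: rcons x false) = inner m.+2 x.
Proof.
move=> sx; rewrite cpeaksE /= ?size_rcons ?sx //; apply/setP=> i.
rewrite !inE last_rcons /= andbT orbC; congr (_ || _).
case: (i : nat) => [|i'] //=; rewrite {1}/peak /= nth_rcons_default nth_rcons.
rewrite sx /peak; case: (ltngtP i' m) => // le_mi;
  by rewrite (nth_default false) ?andbF // sx ?le_mi // ltnW // ltnS ltnW.
Qed.

Lemma cdes_dup_last m x : true \in x -> ballot 0 x ->
  cdes m.+2 (false :: dup_last x) = inner m.+2 x.
Proof.
move=> xT x0; apply/setP=> i.
rewrite !inE framed_dup_last // andbT orbC; congr (_ || _).
case: (i : nat) => [|i'] /=; last exact: peak_dup_last.
rewrite /peak /=; case: x xT x0 => //= -[] //= x.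
Qed.

Lemma cdes_max n (S : {set 'I_n.+1}) w : size w = n.+1 ->
  cdes n.+1 w = S -> (ord_max \in S) = framed w.
Proof. by move=> sw <-; rewrite inE peakF ?sw // eqxx. Qed.

(** * Counting words by cyclic descent set *)

(** The last position is a cyclic peak exactly for the words that start with a
    down step and end with an up step. *)
Lemma count_cpeaks_max m k (S : {set 'I_m.+2}) : ord_max \in S ->
  count (fun w => (cpeaks m.+2 w == S) && (downs w == k.+1)) (words m.+2) =
  count (fun x => (inner m.+2 x == S) && (downs x == k)) (words m).
Proof.
move=> Smax; apply/esym.
apply: (count_words_bij (f := fun x => true :: rcons x false)
                        (g := fun w => behead (take m.+1 w))) => w sw.
  case/andP=> ? /eqP dw; rewrite cpeaks_bracket //= size_rcons sw.
  split=> //; first by apply/andP; rewrite -cats1 count_cat dw addn0.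
  by rewrite -cats1 take_size_cat.
case/andP=> /eqP cw /eqP dw.
have [x E] : exists x, w = true :: rcons x false.
  move: (Smax); rewrite -cw cpeaksE // inE peakF ?sw // eqxx /=.
  case: w sw {cw dw} => //= -[] w; last by rewrite andbF.
  case/lastP: w => //= w b _.
  by rewrite last_rcons; case: b => // _; exists w.
have sx : size x = m by move: sw; rewrite E /= size_rcons => -[].
rewrite E /= -cats1 take_size_cat ?cats1 // sx; split=> //.
rewrite -(cpeaks_bracket sx) -E cw eqxx; move: dw; rewrite E /= -cats1 count_cat.
by move=> /= [<-]; rewrite !addn0.
Qed.

(** The map [x |-> false :: dup_last x] is a bijection onto the framed words; it
    adds one down step and turns the peaks of [x] into [inner]. *)
Lemma count_cdes_max m k (S : {set 'I_m.+2}) : ord_max \in S ->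
  count (fun w => [&& cdes m.+2 w == S, downs w == k.+2 & ballot 0 w])
    (words m.+2) =
  count (fun x => [&& inner m.+2 x == S, downs x == k.+1 & ballot 0 x])
    (words m).
Proof.
move=> Smax; apply/esym.
apply: (count_words_bij (f := fun x => false :: dup_last x)
                        (g := fun w => del_last (behead w))) => w sw.
  case/and3P=> ? /eqP dw w0; have wT : true \in w by rewrite -downs_mem dw.
  rewrite cdes_dup_last //= size_dup_last // sw downs_dup_last // dup_lastK //.
  by rewrite dw ballot_dup_last // eqxx; split=> //; apply/and3P.
case/and3P=> /eqP cw /eqP dw w0.
have : framed w by rewrite -(cdes_max sw cw).
case: w sw cw dw w0 => //= -[] //= y [sy] cw dw y1 /and3P[xT /eqP Ex x0].
have sx : size (del_last y) = m.
  by have := size_dup_last xT; rewrite Ex sy => -[].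
split=> //; last by rewrite Ex.
rewrite x0 -(cdes_dup_last m xT x0) Ex cw eqxx andbT /=.
by have := downs_dup_last xT; rewrite Ex; move: dw; rewrite add0n => -> [<-].
Qed.

Lemma inner_ext n u v : peak u =1 peak v -> inner n u = inner n v.
Proof. by move=> uv; apply/setP=> i; rewrite !inE uv. Qed.

Lemma peaks_ext n u v : peak u =1 peak v -> peaks n u = peaks n v.
Proof. by move=> uv; apply/setP=> i; rewrite !inE uv. Qed.

(** Used both for [f := cpeaks] and for [f := cdes], which extend the linear
    peak set by at most the last position. *)
Lemma count_split_max n (S : {set 'I_n.+1}) (f : seq bool -> {set 'I_n.+1})
    (P : pred (seq bool)) : ord_max \notin S ->
  (forall w, size w = n.+1 ->
     f w = peaks n.+1 w \/ f w = ord_max |: peaks n.+1 w) ->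
  count (fun w => (peaks n.+1 w == S) && P w) (words n.+1) =
  count (fun w => (f w == S) && P w) (words n.+1) +
  count (fun w => (f w == ord_max |: S) && P w) (words n.+1).
Proof.
move=> SN fP; rewrite (count_split _ (fun w => ord_max \notin f w)).
have pN w : size w = n.+1 -> ord_max \notin peaks n.+1 w.
  by move=> sw; rewrite inE peakF ?sw.
congr (_ + _); apply: eq_count_words => w sw; have pNw := pN w sw.
  rewrite andbAC; congr (_ && _).
  have [->|->] := fP w sw; first by rewrite pNw andbT.
  rewrite setU11 andbF; apply/esym/eqP=> E; move: SN.
  by rewrite -E setU11.
rewrite andbAC; congr (_ && _); rewrite negbK.
have [->|->] := fP w sw.
  rewrite (negbTE pNw) andbF; apply/esym/eqP=> E; move: pNw.
  by rewrite E setU11.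
rewrite setU11 andbT; apply/eqP/eqP=> [->|E] //.
by rewrite -(setU1K pNw) E setU1K.
Qed.

Lemma cpeaks_peaks n w : size w = n.+1 ->
  cpeaks n.+1 w = peaks n.+1 w \/ cpeaks n.+1 w = ord_max |: peaks n.+1 w.
Proof.
move=> sw; rewrite cpeaksE //; case: (~~ last true w && head false w).
  by right; apply/setP=> i; rewrite !inE andbT orbC -val_eqE.
by left; apply/setP=> i; rewrite !inE andbF orbF.
Qed.

Lemma cdes_peaks n w :
  cdes n.+1 w = peaks n.+1 w \/ cdes n.+1 w = ord_max |: peaks n.+1 w.
Proof.
rewrite /cdes; case: (framed w).
  by right; apply/setP=> i; rewrite !inE andbT orbC -val_eqE.
by left; apply/setP=> i; rewrite !inE andbF orbF.
Qed.

(** The formula behind the theorem.  Everything on the right, and the second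
    summand on the left, is invariant under rotation of [S]. *)
Lemma count_cdes m k (S : {set 'I_m.+2}) : k.+2 + k.+2 <= m.+2 ->
  count (fun w => [&& cdes m.+2 w == S, downs w == k.+2 & ballot 0 w])
    (words m.+2)
  + count (fun w => (cpeaks m.+2 w == S) && (downs w == k.+1)) (words m.+2) =
  count (fun w => (cpeaks m.+2 w == S) && (downs w == k.+2)) (words m.+2).
Proof.
move=> le_km.
have withmax (S' : {set 'I_m.+2}) : ord_max \in S' ->
  count (fun w => [&& cdes m.+2 w == S', downs w == k.+2 & ballot 0 w])
    (words m.+2)
  + count (fun w => (cpeaks m.+2 w == S') && (downs w == k.+1)) (words m.+2) =
  count (fun w => (cpeaks m.+2 w == S') && (downs w == k.+2)) (words m.+2).
  move=> S'max; rewrite count_cdes_max // !count_cpeaks_max //; apply/esym.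
  apply: count_ballot => [|u v uv]; first lia.
  by rewrite (inner_ext _ uv).
case: (boolP (ord_max \in S)) => [/withmax//|SN].
have Emax := withmax _ (setU11 ord_max S).
have Ec j : _ := @count_split_max m.+1 S (cpeaks m.+2) (fun w => downs w == j)
  SN (@cpeaks_peaks m.+1).
have Ed := @count_split_max m.+1 S (cdes m.+2)
  (fun w => (downs w == k.+2) && ballot 0 w) SN (fun w _ => @cdes_peaks m.+1 w).
(* Without the last position: words with linear peak set [S], minus the case
   of [S] with the last position added. *)
have ext u v : peak u =1 peak v ->
    (peaks m.+2 u == S) = (peaks m.+2 v == S).
  by move=> uv; rewrite (peaks_ext _ uv).
have lt_km : 2 * k.+1 < m.+2 by lia.
by have := count_ballot lt_km ext; rewrite Ed !Ec => Eb; lia.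
Qed.

(** * Rotation *)
Lemma mem_rotate n (S : {set 'I_n}) i : (i \in rotate S) = (ord_pred i \in S).
Proof.
rewrite -{1}[i]ord_predK mem_imset //; exact: can_inj (@ordSK n).
Qed.

Lemma rotate_inj n : injective (@rotate n).
Proof. by apply: imset_inj; apply: can_inj (@ordSK n). Qed.

Lemma rotateP n (S : {set 'I_n}) : exists S', S = rotate S'.
Proof.
exists [set i : 'I_n | ordS i \in S]; apply/setP=> i.
by rewrite mem_rotate inE ord_predK.
Qed.

Lemma nth_rot1 T (b : T) n (w : seq T) (i : 'I_n) : size w = n ->
  nth b (rot 1 w) i = nth b w (ordS i).
Proof.
case: w i => [|a w] i /= sw; subst n; first by case: i.
rewrite rot1_cons nth_rcons; have := ltn_ord i.
rewrite ltnS leq_eqVlt => /predU1P[->|lt_iw].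
  by rewrite ltnn eqxx modnn.
by rewrite lt_iw modn_small.
Qed.

Lemma rotate_cpeaks_rot n w : size w = n ->
  rotate (cpeaks n (rot 1 w)) = cpeaks n w.
Proof.
move=> sw; apply/setP=> i; rewrite mem_rotate !inE.
by rewrite !nth_rot1 // ord_predK.
Qed.

Lemma count_cpeaks_rotate n k (S : {set 'I_n}) :
  count (fun w => (cpeaks n w == rotate S) && (downs w == k)) (words n) =
  count (fun w => (cpeaks n w == S) && (downs w == k)) (words n).
Proof.
have dr w : downs (rot 1 w) = downs w by apply/permP; rewrite perm_rot.
apply: (count_words_bij (f := rot 1) (g := rotr 1)) => w sw.
  rewrite size_rot rotK dr -(rotate_cpeaks_rot sw).
  by rewrite (inj_eq (@rotate_inj n)).
rewrite size_rotr -(dr (rotr 1 w)) -(rotate_cpeaks_rot (w := rotr 1 w));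
  last by rewrite size_rotr.
by rewrite rotrK (inj_eq (@rotate_inj n)).
Qed.

(** * Positions of letters, and the two conditions on entries *)

(** The 0-based position of the letter [b] that is preceded by [j] letters [b].
    It is the length of [w] when there is none. *)
Fixpoint pos (b : bool) (j : nat) (w : seq bool) : nat :=
  if w is a :: w' then
    if eqb b a then (if j is j'.+1 then (pos b j' w').+1 else 0)
    else (pos b j w').+1
  else 0.

(** Positions and prefix counts determine each other; comparisons of tableau
    entries are reduced to this equivalence. *)
Lemma pos_lt b j w t : t <= size w ->
  (pos b j w < t) = (j < letters b (take t w)).
Proof.
elim: w j t => [|a w IHw] j [|t] //= le_tw.
case: (eqb b a) => //=; last by rewrite ltnS IHw.
by case: j => [|j] //; rewrite !ltnS IHw.
Qed.

Lemma nth_pos b j w : j < letters b w -> nth (~~ b) w (pos b j w) = b.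
Proof.
elim: w j => [|a w IHw] j //=.
case E: (eqb b a) => /=; last exact: IHw.
by case: j => [|j] lt_j; [move: E; clear; case: a; case: b | apply: IHw].
Qed.

Lemma letters_pos b j w : j < letters b w -> letters b (take (pos b j w) w) = j.
Proof.
elim: w j => [|a w IHw] j //=.
case E: (eqb b a) => /=; last by rewrite E; apply: IHw.
by case: j => [|j] lt_j //=; rewrite E IHw.
Qed.

Lemma nth_pos_eq b j w t : t < size w ->
  (pos b j w == t) && (j < letters b w) =
  (nth (~~ b) w t == b) && (letters b (take t w) == j).
Proof.
elim: w j t => [|a w IHw] j [|t] //= lt_tw.
  by clear; case: a; case: b; case: j.
case E: (eqb b a) => /=; last by rewrite eqSS IHw.
by case: j => [|j]; [rewrite andbF | rewrite !eqSS ltnS IHw].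
Qed.

(** The second condition says that the path is at height at least 1 after each
    of its first [k] down steps.  Hence it is positive between the first step
    and the last two down steps, which the first condition makes adjacent: what
    remains after deletion of the first up step and of one of these two down
    steps is ballot, and conversely. *)
Lemma framedP n k w : size w = n -> ballot 0 w -> downs w = k.+2 ->
  2 * k.+2 <= n ->
  reflect (pos true k.+1 w = (pos true k w).+1 /\
           forall i, i < k -> pos false i.+1 w < pos true i w)
          (framed w).
Proof.
move=> sw w0 dw le_kn; apply: (iffP idP) => [|[consec above]].
  case: w sw w0 dw => //= -[] //= y sy y1 dy /and3P[xT /eqP Ex].
  have [z [s [Ez sN]]] := last_down xT; rewrite Ez in Ex *.
  rewrite ballot_cat => /andP[z0 _].
  have s0 : downs s = 0 by apply/eqP; rewrite -leqn0 leqNgt downs_mem.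
  have E : y = z ++ [:: true, true & s] by rewrite -Ex dup_lastE.
  have dz : downs z = k by move: dy; rewrite E count_cat /= s0; lia.
  have szy : size z + (size s).+2 = size y by rewrite E size_cat.
  have take_y t : t <= size z -> take t y = take t z.
    by move=> le_tz; rewrite E takel_cat.
  have take_z t : take (size z + t) y = z ++ take t [:: true, true & s].
    by rewrite E take_cat ltnNge leq_addr addKn.
  split.
    have P1 : (pos true k y < size z + 1).
      by rewrite pos_lt; [rewrite take_z count_cat dz /= ?take0 /=; lia | lia].
    have P2 : (size z <= pos true k y).
      by rewrite leqNgt pos_lt ?take_y ?take_size ?dz ?ltnn //; lia.
    have P3 : (pos true k.+1 y < size z + 2).
      by rewrite pos_lt; [rewrite take_z count_cat dz /= ?take0 /=; lia | lia].
    have P4 : (size z + 1 <= pos true k.+1 y).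
      rewrite leqNgt pos_lt; last lia.
      by rewrite take_z count_cat dz /= ?take0 /=; lia.
    lia.
  move=> i lt_ik; rewrite ltnS; set q := pos true i y.
  have lt_qz : q < size z by rewrite pos_lt ?take_y ?take_size ?dz //; lia.
  have Hq : i < downs (take q.+1 y) by rewrite -pos_lt //; lia.
  have bal : downs (take q.+1 z) <= ups (take q.+1 z).
    by have /ballotP/(_ q.+1) := z0.
  have : pos false i y < q.+1.
    by rewrite pos_lt ?take_y //; rewrite take_y // in Hq; lia.
  rewrite ltnS leq_eqVlt => /predU1P[Eq|//].
  (* Strictness: an up step and a down step have different positions. *)
  have iU : i < ups y by rewrite -[y in ups y]take_size -pos_lt // Eq; lia.
  have iD : i < downs y by rewrite -[y in downs y]take_size -pos_lt // -/q; lia.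
  have := nth_pos iU; have := nth_pos iD; rewrite /= Eq -/q.
  have lt_qy : q < size y by lia.
  by rewrite (set_nth_default true) // => ->.
set p := pos true k w in consec.
have lt_p2 : p.+1 < n.
  by rewrite -consec -sw pos_lt // take_size dw.
have np : nth false w p = true by apply: nth_pos; rewrite dw.
have np1 : nth false w p.+1 = true.
  by rewrite -consec; apply: nth_pos; rewrite dw.
(* Cut at [p]: the prefix has [k] downs, so nothing but ups comes after the
   adjacent pair. *)
have E : w = take p w ++ [:: true, true & drop p.+2 w].
  rewrite -{1}[w](cat_take_drop p); congr (_ ++ _).
  by rewrite (drop_nth false) ?np ?(drop_nth false (n := p.+1)) ?np1 // sw //; lia.
have dp : downs (take p w) = k by rewrite letters_pos ?dw.
move: E dp; set z := take p w; set s := drop _ _ => E dz.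
have ds : downs s = 0 by move: dw; rewrite E count_cat /= dz; lia.
have sN : true \notin s by rewrite -downs_mem ds.
have szp : size z = p by rewrite size_take sw; case: ltnP => //; lia.
have take_w t : t <= p -> take t w = take t z.
  by move=> le_tp; rewrite /z take_takel.
case: z E dz szp take_w => [|[] z] E dz szp take_w.
- by move: w0; rewrite E.
- by move: w0; rewrite E.
have Ed : del_last (z ++ [:: true, true & s]) = z ++ true :: s.
  by rewrite -cat1s catA del_lastE // -catA.
rewrite E /= Ed mem_cat inE eqxx orbT dup_lastE // eqxx /=.
have z0 : ballot 0 z.
  apply/ballotP=> t; rewrite add0n.
  wlog le_tz : t / t <= size z => [Hw|].
    case: (leqP t (size z)) => [/Hw//|/ltnW le_zt].
    by rewrite (take_oversize le_zt) -[z]take_size; apply: Hw.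
  have le_tp : t.+1 <= p by rewrite -szp.
  rewrite leqNgt; apply/negP=> lt_ud.
  have le_dk : downs (take t z) <= k.
    by rewrite -dz /= -{2}(cat_take_drop t z) count_cat; lia.
  case Ed' : (downs (take t z)) => [|i]; first lia.
  have lt_it : pos true i w < t.+1 by rewrite pos_lt ?take_w //= ?Ed'; lia.
  have := ltn_trans (above i _) lt_it.
  rewrite pos_lt ?sw; last lia.
  rewrite take_w //= => /(_ _); lia.
rewrite ballot_cat z0 /= ballot_no_down ?andbT //.
have := w0; rewrite E /= ballot_cat /= => /andP[_].
by case/and3P; lia.
Qed.

(** * Two-row tableaux as ballot words *)
Notation tworow n p k := (SYT n [:: p; k] [::]).

Definition lower p k (c : cell [:: p; k] [::]) : bool := row c == 2.

Definition rowlen (p k : nat) (b : bool) : nat := if b then k else p.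

Lemma rowE p k (c : cell [:: p; k] [::]) : row c = (lower c).+1.
Proof. by case: c => -[[[|[|]] ?] j]. Qed.

Lemma col_rowlen p k (c : cell [:: p; k] [::]) :
  (col c).-1 < rowlen p k (lower c).
Proof. by case: c => -[[[|[|]] // ?] j]; rewrite /in_skew /= => /andP[]. Qed.

Lemma cell_eq p k (c d : cell [:: p; k] [::]) :
  lower c = lower d -> col c = col d -> c = d.
Proof.
move=> Er [Ec]; apply/val_inj; apply/eqP; rewrite -pair_eqE.
apply/andP; split; apply/eqP/val_inj => //=.
by have := rowE c; rewrite Er -rowE => -[].
Qed.

Lemma cell_exists p k b j : k <= p -> j < rowlen p k b ->
  exists c : cell [:: p; k] [::], lower c = b /\ col c = j.+1.
Proof.
move=> le_kp lt_j; have lt_jp : j < p by move: lt_j; case: b => /=; lia.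
have lt_b2 : (b : nat) < 2 by case: b {lt_j}.
have cP : @in_skew [:: p; k] [::] (Ordinal lt_b2, Ordinal lt_jp).
  by rewrite /in_skew /=; case: b lt_j {lt_b2}.
by exists (Cell cP); split=> //; rewrite /lower /row /=; case: b {lt_j lt_b2 cP}.
Qed.

Definition word n p k (T : tworow n p k) : seq bool :=
  mkseq (fun v => [exists c, (T c == v :> nat) && lower c]) n.

Lemma size_word n p k (T : tworow n p k) : size (word T) = n.
Proof. exact: size_mkseq. Qed.

Lemma syt_inj n p k (T : tworow n p k) : injective T.
Proof.
have /and3P[/forallP T1 _ _] := syt_valP T.
move=> c d Ecd; have /cards1P[e E] := T1 (T d).
have: c \in [set c | T c == T d] by rewrite inE Ecd.
have: d \in [set c | T c == T d] by rewrite inE.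
by rewrite E !inE => /eqP-> /eqP.
Qed.

Lemma syt_surj n p k (T : tworow n p k) v : exists c, T c = v.
Proof.
have /and3P[/forallP/(_ v)/cards1P[e E] _ _] := syt_valP T.
by exists e; apply/eqP; have := set11 e; rewrite -E inE.
Qed.

Lemma syt_row n p k (T : tworow n p k) c d :
  lower c = lower d -> col c < col d -> T c < T d.
Proof.
have /and3P[_ /forallP/(_ c)/forallP/(_ d)/implyP Tr _] := syt_valP T.
by move=> Er lt_cd; apply: Tr; rewrite !rowE Er eqxx.
Qed.

Lemma syt_col n p k (T : tworow n p k) c d :
  col c = col d -> ~~ lower c -> lower d -> T c < T d.
Proof.
have /and3P[_ _ /forallP/(_ c)/forallP/(_ d)/implyP Tc] := syt_valP T.
by move=> Ec cN dL; apply: Tc; rewrite !rowE Ec eqxx dL; case: lower cN.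
Qed.

Lemma nth_word n p k (T : tworow n p k) c b : nth b (word T) (T c) = lower c.
Proof.
rewrite nth_mkseq //; apply/existsP/idP => [[d]|cL].
  by case/andP=> /eqP/val_inj/syt_inj->.
by exists c; rewrite eqxx.
Qed.

(** The entries of a row below a threshold fill an initial segment of that row,
    whose length is the number of letters of that row in the prefix of the
    word.  By induction on the threshold: the cell holding the next entry must be
    the first one not yet filled in its row, because rows increase. *)
Lemma syt_lt n p k (T : tworow n p k) c t : k <= p -> t <= n ->
  (T c < t) = ((col c).-1 < letters (lower c) (take t (word T))).
Proof.
move=> le_kp; elim: t c => [|t IHt] c lt_tn; first by rewrite take0.
have [d Ed] := syt_surj T (Ordinal lt_tn).
have Edt : T d = t :> nat by rewrite Ed.
rewrite (take_nth false) ?size_word // -Edt nth_word Edt -cats1 count_cat /=.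
rewrite addn0 ltnS leq_eqVlt IHt ?(ltnW lt_tn) //.
case: (eqVneq (lower c) (lower d)) => [Ecd|Ncd]; last first.
  have -> : eqb (lower c) (lower d) = false.
    by move: Ncd; case: (lower c); case: (lower d).
  rewrite addn0; case: eqP => //; rewrite -Edt => /val_inj/syt_inj Ecd.
  by rewrite Ecd eqxx in Ncd.
have -> : eqb (lower c) (lower d) by rewrite Ecd; case: (lower d).
rewrite Ecd addn1 ltnS [RHS]leq_eqVlt; congr (_ || _).
have Ld : (col d).-1 = letters (lower d) (take t (word T)).
  apply/eqP; rewrite eqn_leq [X in _ && X]leqNgt -IHt ?(ltnW lt_tn) // Edt ltnn.
  rewrite andbT leqNgt; apply/negP=> lt_Ld.
  have [e [Ere Ece]] := cell_exists le_kp (ltn_trans lt_Ld (col_rowlen d)).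
  have : T e < t by rewrite -Edt; apply: syt_row; rewrite // Ece; lia.
  by rewrite IHt ?(ltnW lt_tn) // Ere Ece ltnn.
rewrite -Ld -{1}Edt; apply/eqP/eqP => [/val_inj/syt_inj->//|Ec].
by congr (val (T _)); apply: cell_eq; rewrite // /col Ec.
Qed.

Lemma syt_pos n p k (T : tworow n p k) c : k <= p ->
  T c = pos (lower c) (col c).-1 (word T) :> nat.
Proof.
move=> le_kp; have lt_iff t : t <= n ->
    (T c < t) = (pos (lower c) (col c).-1 (word T) < t).
  by move=> le_tn; rewrite syt_lt // pos_lt ?size_word.
have ltT := ltn_ord (T c); have ltP := ltT; rewrite lt_iff // in ltP.
have := lt_iff _ ltT; have := lt_iff _ ltP; rewrite !ltnS !leqnn.
lia.
Qed.

(** Each row of the shape is exhausted by the whole word, which gives one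
    inequality per row; their sum is an equality. *)
Lemma letters_word n p k (T : tworow n p k) b : k <= p -> p + k = n ->
  letters b (word T) = rowlen p k b.
Proof.
move=> le_kp Epk.
have ge b' : rowlen p k b' <= letters b' (word T).
  case Er: (rowlen p k b') => [|j] //.
  have [c [Erc Ecc]] : exists c : cell [:: p; k] [::],
    lower c = b' /\ col c = j.+1 by apply: cell_exists; rewrite // Er.
  have := ltn_ord (T c).
  by rewrite syt_lt // Erc Ecc take_oversize ?size_word.
have := ge true; have := ge false; have := ups_downs (word T).
by rewrite size_word /=; case: b => /=; lia.
Qed.

(** If a prefix contains the [j]-th lower entry, it contains the smaller upper
    entry of the same column. *)
Lemma ballot_word n p k (T : tworow n p k) : k <= p -> p + k = n ->
  ballot 0 (word T).
Proof.
move=> le_kp Epk; apply/ballotP=> t; rewrite add0n.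
wlog le_tn : t / t <= n => [Hw|].
  case: (leqP t n) => [/Hw//|/ltnW le_nt].
  rewrite take_oversize ?size_word // -[word T]take_size.
  by apply: Hw; rewrite size_word.
case Ed: (downs _) => [|j] //.
have lt_jk : j < k.
  have := letters_word T true le_kp Epk.
  by rewrite -{1}[word T](cat_take_drop t) count_cat Ed /=; lia.
have [d [Erd Ecd]] := @cell_exists p k true j le_kp lt_jk.
have [c [Erc Ecc]] := @cell_exists p k false j le_kp (leq_trans lt_jk le_kp).
have : T c < t.
  apply: (@ltn_trans (T d)); last by rewrite syt_lt // Erd Ecd Ed.
  by apply: syt_col; rewrite ?Erc ?Erd ?Ecc ?Ecd.
by rewrite syt_lt // Erc Ecc.
Qed.

Lemma word_inj n p k : k <= p -> injective (@word n p k).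
Proof.
move=> le_kp T T' E; apply/val_inj/ffunP => c; apply: val_inj.
by rewrite /= !syt_pos // E.
Qed.

(** The tableau is recovered by putting in each cell the position of the
    corresponding letter. *)
Lemma word_onto n p k w : k <= p -> p + k = n -> size w = n -> ballot 0 w ->
  downs w = k -> exists T : tworow n p k, word T = w.
Proof.
move=> le_kp Epk sw w0 dw; have ud := ups_downs w.
have rl b : rowlen p k b = letters b w by case: b => /=; lia.
have lt_c (c : cell [:: p; k] [::]) : (col c).-1 < letters (lower c) w.
  by rewrite -rl col_rowlen.
have lt_n (c : cell [:: p; k] [::]) : pos (lower c) (col c).-1 w < n.
  by rewrite -sw pos_lt // take_size.
pose T := [ffun c : cell [:: p; k] [::] => Ordinal (lt_n c)].
have ET c : T c = pos (lower c) (col c).-1 w :> nat by rewrite ffunE.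
have nthT c b : nth b w (T c) = lower c.
  by rewrite (set_nth_default (~~ lower c)) ?sw // ET nth_pos.
have T_eq c (v : 'I_n) : (T c == v) =
    (nth (~~ lower c) w v == lower c)
    && (letters (lower c) (take v w) == (col c).-1).
  by rewrite -nth_pos_eq ?sw // lt_c andbT -val_eqE /= ET.
have TP : is_SYT T.
  apply/and3P; split.
  - apply/forallP=> v; apply/cards1P.
    have lt_j : letters (nth true w v) (take v w) < rowlen p k (nth true w v).
      rewrite rl; move Eb: (nth true w v) => b.
      rewrite -{2}[w](cat_take_drop v) count_cat (drop_nth true) ?sw //= Eb.
      by case: (b) => /=; lia.
    have [c [Erc Ecc]] := cell_exists le_kp lt_j.
    have Tc : T c = v.
      apply/eqP; rewrite T_eq Erc Ecc (set_nth_default true) ?sw //.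
      by rewrite !eqxx.
    exists c; apply/setP=> d; rewrite !inE; apply/idP/eqP => [|->]; last first.
      by rewrite Tc.
    move=> Td; have := Td; rewrite T_eq (set_nth_default true) ?sw //.
    case/andP=> /eqP Erd /eqP Ecd; apply: cell_eq; first by rewrite Erc.
    by move: Ecd; rewrite -Erd Ecc => ->; rewrite prednK.
  - apply/forallP=> c; apply/forallP=> d; apply/implyP=> /andP[/eqP Er lt_cd].
    have {}Er : lower c = lower d by rewrite /lower Er.
    rewrite !ET pos_lt; last by rewrite -ET sw ltnW.
    by rewrite Er letters_pos //; move: lt_cd; rewrite /col; lia.
  apply/forallP=> c; apply/forallP=> d; apply/implyP=> /andP[/eqP Ec].
  rewrite !rowE ltnS; case Lc: (lower c); case Ld: (lower d) => // _.
  have lt_d : (col d).-1 < downs w by rewrite -Ld.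
  have lt_P : pos true (col d).-1 w < size w by rewrite pos_lt // take_size.
  rewrite (ET c) (ET d) Lc Ld Ec pos_lt; last exact: ltnW.
  have /ballotP/(_ (pos true (col d).-1 w).+1) := w0.
  rewrite (take_nth false) // (nth_pos lt_d) -cats1 !count_cat /= letters_pos //.
  by rewrite add0n !addn0 addn1.
exists (MkSYT TP); apply: (@eq_from_nth _ true); rewrite size_word // => v lt_v.
have [c Ec] := syt_surj (MkSYT TP) (Ordinal lt_v).
rewrite -[v]/(val (Ordinal lt_v)) -Ec nth_word.
by rewrite -[LHS](nthT c true).
Qed.

Lemma Des_word n p k (T : tworow n p k) : Des T = peaks n (word T).
Proof.
apply/setP=> m; rewrite !inE; apply/existsP/andP.
  case=> c /existsP[d /and3P[/eqP Ec /eqP Ed]].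
  rewrite !rowE -Ed -Ec !nth_word.
  by case: (lower c); case: (lower d).
case=> upm downm; have lt_mn : m.+1 < n.
  rewrite ltnNge; apply/negP=> le_nm; move: downm.
  by rewrite nth_default ?size_word.
have [c Ec] := syt_surj T m; have [d Ed] := syt_surj T (Ordinal lt_mn).
exists c; apply/existsP; exists d; rewrite Ec Ed !eqxx /= !rowE.
have Edm : T d = m.+1 :> nat by rewrite Ed.
move: upm downm; rewrite -Edm nth_word -Ec nth_word.
by case: (lower c); case: (lower d).
Qed.

Lemma entry_pos n p k (T : tworow n p k) (b : bool) j : k <= p ->
  j < rowlen p k b -> entry T b.+1 j.+1 = (pos b j (word T)).+1.
Proof.
move=> le_kp /(cell_exists le_kp)[c [Erc Ecc]]; rewrite /entry.
case: pickP => [d|/(_ c)]; last by rewrite rowE Erc Ecc !eqxx.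
case/andP; rewrite rowE => /eqP[Er] /eqP Ec.
rewrite syt_pos // Ec /=; congr (pos _ _ _).+1.
by move: Er; case: (lower d); case: (b).
Qed.

(** * The cyclic descent map *)
Theorem theorem1p6 (n k : nat) (hk2 : 2 <= k) (hkn : 2 * k <= n) :
  exists cDes : SYT n [:: n - k; k] [::] -> {set 'I_n},
    cyclic_descent_map cDes /\
    forall (T : SYT n [:: n - k; k] [::]) (m : 'I_n), m.+1 = n ->
      (m \in cDes T <->
         entry T 2 k = entry T 2 (k - 1) + 1 /\
         forall i : nat, 1 < i < k -> entry T 2 (i - 1) > entry T 1 i).
Proof.
have le_kp : k <= n - k by lia.
have Epk : n - k + k = n by lia.
exists (fun T => cdes n (word T)); split; first split.
- move=> T; rewrite Des_word; apply/setP=> i; rewrite !inE.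
  case: (ltngtP i.+1 n) (ltn_ord i) => // [lt_in|Ei] _.
    by rewrite andbT orbF.
  by rewrite andbF peakF // size_word Ei.
- have words_syt : perm_eq [seq word T | T : tworow n (n - k) k]
      [seq w <- words n | (downs w == k) && ballot 0 w].
    apply: uniq_perm.
    - by rewrite map_inj_uniq ?enum_uniq //; apply: word_inj.
    - by rewrite filter_uniq ?uniq_words.
    move=> w; rewrite mem_filter mem_words; apply/imageP/idP => [[T _ ->]|].
      by rewrite size_word ballot_word // letters_word //= !eqxx.
    case/andP=> /andP[/eqP dw w0] /eqP sw.
    by have [T <-] := word_onto le_kp Epk sw w0 dw; exists T.
  have count_syt S :
      count_mem S [seq cdes n (word T) | T : tworow n (n - k) k] =
      count (fun w => [&& cdes n w == S, downs w == k & ballot 0 w]) (words n).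
    rewrite count_map -(count_map (@word _ _ _) (fun w => cdes n w == S)).
    by have /permP-> := words_syt; rewrite count_filter.
  have count_inv S :
      count_mem (rotate S) [seq cdes n (word T) | T : tworow n (n - k) k] =
      count_mem S [seq cdes n (word T) | T : tworow n (n - k) k].
    rewrite !count_syt.
    case: n k hk2 hkn {words_syt count_syt le_kp Epk} S => [|[|m]] [|[|k]] //;
      try by lia.
    move=> _ hkn S; have le_km : k.+2 + k.+2 <= m.+2 by lia.
    have := count_cdes S le_km; have := count_cdes (rotate S) le_km.
    by rewrite !count_cpeaks_rotate => <- /addIn.
  apply/allP=> S _; have [S' ->] := rotateP S.
  rewrite /= count_inv !count_map; apply/eqP/eq_count => T /=.
  by rewrite (inj_eq (@rotate_inj n)).
move=> T i Ei.
have sw := size_word T; have w0 := ballot_word T le_kp Epk.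
have dw := letters_word T true le_kp Epk.
have EN j : j < k -> entry T 2 j.+1 = (pos true j (word T)).+1.
  exact: (@entry_pos n (n - k) k T true).
have EU j : j < k -> entry T 1 j.+1 = (pos false j (word T)).+1.
  by move=> lt_jk; apply: (@entry_pos n (n - k) k T false) => //=; lia.
(* The last position is never a linear peak, so it is decided by [framed]. *)
rewrite inE peakF ?sw ?Ei // eqxx /=.
case: k hk2 hkn {le_kp Epk} T sw w0 dw EN EU => [|[|k]] // _ hkn T.
move=> sw w0 dw EN EU.
have framedE := framedP sw w0 dw hkn.
rewrite subn1 /= !EN // addn1.
split=> [/framedE[consec above]|[consec above]]; last apply/framedE; split.
- by rewrite consec.
- case=> [|[|j]] // lt_jk; rewrite subn1 /= EN ?EU ?ltnS; try lia.
  by apply: above; lia.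
- by case: consec.
- by move=> j lt_jk; have := above j.+2; rewrite subn1 /= EN ?EU; lia.
Qed.
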